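(* Let $M$ be any complete Riemannian manifold with Riemannian distance $\mathbf{d}$. For $a\in(0,1)$ and $x,y,z\in M$ set $$F_{a;x,y}(z):=(1-a)\,\mathbf{d}(x,z)^2+a\,\mathbf{d}(z,y)^2-a(1-a)\,\mathbf{d}(x,y)^2 .$$ Then for every $a\in(0,1)$ and all $x,y,z\in M$, $$F_{a;x,y}(z)\ge\big(\mathbf{d}(x,z)-a\,\mathbf{d}(x,y)\big)^2 .$$
   Context: $M$ is connected, so $\mathbf{d}$ is a finite metric. *)

(* Defs.v *)
From mathcomp Require Import all_boot all_order all_algebra.
From mathcomp Require Import all_classical all_reals all_analysis.

Set Implicit Arguments.
Unset Strict Implicit.
Unset Printing Implicit Defensive.

Import Order.TTheory GRing.Theory Num.Theory.
Import numFieldNormedType.Exports.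

Local Open Scope classical_set_scope.
Local Open Scope ring_scope.

(* f is of class C^k on U. Meant for open U: continuity and differentiability
   are those of f at the points of U in the ambient space, and the derivative
   x |-> 'd f x is required to be C^(k-1) through its values on each fixed
   vector v, which is equivalent in finite dimension. *)
Fixpoint class_C {R : realType} {V W : normedModType R} (k : nat)
    (U : set V) (f : V -> W) : Prop :=
  {in U, continuous f} /\
  (if k is k'.+1 then
     {in U, forall x, differentiable f x} /\
     forall v : V, class_C k' U (fun x => 'd f x v)
   else True).

Definition smooth_on {R : realType} {V W : normedModType R}
    (U : set V) (f : V -> W) : Prop := forall k, class_C k U f.

(* Smooth n-manifold without boundary: a Hausdorff second countable space with
   a smooth atlas. Charts and their inverses are total functions, meaningful
   only on dom i and on its image; a preferred chart is chosen around every
   point, which in particular says that the charts cover. *)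
Record smoothManifold (R : realType) (n : nat) := SmoothManifold {
  mcarrier :> topologicalType ;
  mhausdorff : hausdorff_space mcarrier ;
  mcountable : @second_countable mcarrier ;
  chart_index : Type ;
  dom : chart_index -> set mcarrier ;
  chart : chart_index -> mcarrier -> 'rV[R]_n ;
  chart_inv : chart_index -> 'rV[R]_n -> mcarrier ;
  chart_at : mcarrier -> chart_index ;
  dom_open : forall i, open (dom i) ;
  cod_open : forall i, open (chart i @` dom i) ;
  chart_continuous : forall i, {in dom i, continuous (chart i)} ;
  chart_inv_continuous : forall i,
    {in chart i @` dom i, continuous (chart_inv i)} ;
  chartK : forall i, {in dom i, cancel (chart i) (chart_inv i)} ;
  dom_chart_at : forall x, dom (chart_at x) x ;
  transition_smooth : forall i j,
    smooth_on (chart i @` (dom i `&` dom j)) (chart j \o chart_inv i)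
}.

Definition gram {R : realType} {n : nat} (A : 'M[R]_n) (u v : 'rV[R]_n) : R :=
  (u *m A *m v^T) 0 0.

(* A Riemannian metric is given by its matrix of components in each chart, as a
   function on the image of that chart; tangent vectors change coordinates by
   the differential of the transition map. *)
Record riemannianManifold (R : realType) (n : nat) := RiemannianManifold {
  rcarrier :> smoothManifold R n ;
  metric : chart_index rcarrier -> 'rV[R]_n -> 'M[R]_n ;
  metric_smooth : forall i, smooth_on (chart i @` dom i) (metric i) ;
  metric_sym : forall i p, (chart i @` dom i) p -> (metric i p)^T = metric i p ;
  metric_pos : forall i p, (chart i @` dom i) p ->
    forall u, u != 0 -> 0 < gram (metric i p) u u ;
  metric_transition : forall i j x, dom i x -> dom j x -> forall u v,
    gram (metric i (chart i x)) u v =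
    gram (metric j (chart j x))
      ('d (chart j \o chart_inv i) (chart i x) u)
      ('d (chart j \o chart_inv i) (chart i x) v)
}.

Section RiemannianDistance.
Context {R : realType} {n : nat}.

Definition C1_curve (M : smoothManifold R n) (J : set R) (c : R -> M) : Prop :=
  {in J, continuous c} /\
  forall i : chart_index M, class_C 1 (J `&` c @^-1` dom i) (chart i \o c).

(* A curve is C^1 on a closed interval, end points included, if it is there the
   restriction of a C^1 curve defined on a larger open set. *)
Definition C1_on_segment (M : smoothManifold R n) (c : R -> M) (s t : R) : Prop :=
  exists (J : set R) (c' : R -> M),
    [/\ open J, `[s, t] `<=` J, C1_curve J c' & {in `[s, t], c =1 c'}].

Definition piecewise_C1 (M : smoothManifold R n) (a b : R) (c : R -> M) : Prop :=
  exists2 s : seq R, itv_partition a b s &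
    forall k, (k < size s)%N -> C1_on_segment c (nth b (a :: s) k) (nth b s k).

(* |c'(t)|, computed in the preferred chart around c t. It is a junk value at
   the finitely many break points of a piecewise C^1 curve. *)
Definition speed (M : riemannianManifold R n) (c : R -> M) (t : R) : R :=
  let i := chart_at (c t) in
  let v := derive1 (chart i \o c) t in
  Num.sqrt (gram (metric i (chart i (c t))) v v).

Definition curve_length (M : riemannianManifold R n) (a b : R) (c : R -> M) :
    \bar R :=
  (\int[lebesgue_measure]_(t in `[a, b]) (speed c t)%:E)%E.

Definition riemannian_edist (M : riemannianManifold R n) (x y : M) : \bar R :=
  ereal_inf [set L | exists a b (c : R -> M),
    [/\ a <= b, piecewise_C1 a b c, c a = x, c b = y & L = curve_length a b c]].

(* No information is lost by [fine] when M is connected. *)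
Definition riemannian_dist (M : riemannianManifold R n) (x y : M) : R :=
  fine (riemannian_edist x y).

Definition riemannian_complete (M : riemannianManifold R n) : Prop :=
  forall u : nat -> M,
    (forall e : R, 0 < e -> exists N : nat, forall p q : nat,
       (N <= p)%N -> (N <= q)%N -> riemannian_dist (u p) (u q) < e) ->
    exists l : M, riemannian_dist (u k) l @[k --> \oo] --> (0 : R).

Definition F (M : riemannianManifold R n) (a : R) (x y z : M) : R :=
  (1 - a) * riemannian_dist x z ^+ 2 + a * riemannian_dist z y ^+ 2
  - a * (1 - a) * riemannian_dist x y ^+ 2.

End RiemannianDistance.

(* Main.v *)
Require Import Defs.
From mathcomp Require Import all_boot all_order all_algebra.
From mathcomp Require Import all_classical all_reals all_analysis.
From mathcomp Require Import measurable_realfun ring lra.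

Set Implicit Arguments.
Unset Strict Implicit.
Unset Printing Implicit Defensive.

Import Order.TTheory GRing.Theory Num.Theory.
Import numFieldNormedType.Exports.

Local Open Scope classical_set_scope.
Local Open Scope ring_scope.

(* Put p = d(x,z), q = d(z,y), r = d(x,y). Then
   F_{a;x,y}(z) - (p - a r)^2 = a (q^2 - (p - r)^2), so that the inequality
   amounts to |p - r| <= q, i.e. to the symmetry and the triangle inequality of
   the Riemannian distance, which is finite because M is connected.

   Lengths of curves can be added and reparametrized because the speed of a
   C^1 curve is continuous: by the transition rule of the metric and the chain
   rule, the speed may be computed in one fixed chart near any given time.
   Finiteness holds locally, along the segments of a chart, hence globally by
   connectedness. *)

(** * The Gram form, and derivatives of composite maps *)

Lemma gramE (R : realType) (n : nat) (A : 'M[R]_n) (u v : 'rV[R]_n) :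
  gram A u v = \sum_j (\sum_i u 0 i * A i j) * v 0 j.
Proof.
rewrite /gram mxE; apply: eq_bigr => j _.
by rewrite !mxE.
Qed.

Lemma gramNN (R : realType) (n : nat) (A : 'M[R]_n) (u v : 'rV[R]_n) :
  gram A (- u) (- v) = gram A u v.
Proof. by rewrite /gram mulNmx linearN /= mulNmx mulmxN opprK. Qed.

Lemma cvg_gram (R : realType) (n : nat) (T : Type) (F : set_system T)
    (FF : Filter F) (A : T -> 'M[R]_n) (u v : T -> 'rV[R]_n)
    (A0 : 'M[R]_n) (u0 v0 : 'rV[R]_n) :
  A @ F --> A0 -> u @ F --> u0 -> v @ F --> v0 ->
  gram (A t) (u t) (v t) @[t --> F] --> gram A0 u0 v0.
Proof.
move=> cA cu cv.
under eq_fun do rewrite gramE.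
have cX m p i j (B : T -> 'M[R]_(m, p)) (B0 : 'M[R]_(m, p)) :
    B @ F --> B0 -> B t i j @[t --> F] --> B0 i j.
  by move=> cB; exact: (continuous_cvg _ (@coord_continuous R m p i j B0) cB).
rewrite gramE; apply: cvg_big => [|j _]; first exact: add_continuous.
apply: cvgM; last exact: cX.
apply: cvg_big => [|i _]; first exact: add_continuous.
by apply: cvgM; exact: cX.
Qed.

Lemma derive1_diff_comp (R : realType) (V W : normedModType R) (f : R -> V)
    (g : V -> W) (t : R) : differentiable f t -> differentiable g (f t) ->
  derive1 (g \o f) t = 'd g (f t) ('d f t 1).
Proof.
move=> df dg; rewrite derive1E deriveE; last exact: differentiable_comp.
by rewrite diff_comp.
Qed.

Lemma near_eq_derive1 (R : realType) (V : normedModType R) (f g : R -> V)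
    (t : R) : {near t, f =1 g} -> derive1 f t = derive1 g t.
Proof. by move=> fg; rewrite !derive1E; exact: near_eq_derive. Qed.

(** By the chain rule the derivative of [f \o l] at [s] sends [v] to ['d f (l s) (v *: w)]. As [l]
    is affine, the vector [v *: w] does not depend on [s], so continuity in [s] is the continuity of
    ['d f] on a fixed vector. This serves both for reflections of time and for straight lines in a
    chart. *)
Lemma class_C1_comp_affine (R : realType) (V W : normedModType R) (U : set V) (f : V -> W)
    (l : R -> V) (p w : V) : open U -> (forall t, l t = p + t *: w) ->
  class_C 1 U f -> class_C 1 (l @^-1` U) (f \o l).
Proof.
move=> oU lE [cf [df cdf]].
have dl t : is_diff t l (fun s => s *: w).
  have -> : l = cst p + (fun s => s *: w) by apply/funext => s; rewrite lE.
  by apply: is_diff_eq; rewrite add0r.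
have cl : continuous l by move=> t; apply: differentiable_continuous.
have lU t : t \in l @^-1` U -> l t \in U by rewrite !inE.
split; [|split].
- by move=> t /lU Ut; apply: continuous_comp; [exact: cl|exact: cf].
- by move=> t /lU Ut; apply: differentiable_comp => //; exact: df.
- move=> v; split=> // t tU.
  have lUt := lU _ tU.
  have dE s : s \in l @^-1` U -> 'd (f \o l) s v = 'd f (l s) (v *: w).
    move=> /lU Us; rewrite diff_comp//; last exact: df.
    by rewrite /= diff_val.
  suff cdfl y : y = 'd f (l t) (v *: w) -> 'd (f \o l) s v @[s --> t] --> y.
    exact: (cdfl _ (dE _ tU)).
  move=> ->; apply: cvg_trans.
    apply: (@near_eq_cvg _ _ _ _ (fun s => 'd f (l s) (v *: w))).
    near=> s; rewrite dE// inE; near: s.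
    by apply: cl; apply: open_nbhs_nbhs; split=> //; move: lUt; rewrite inE.
  apply: (@continuous_cvg _ _ _ _ _ l (fun x => 'd f x (v *: w))).
    by have [+ _] := cdf (v *: w); apply.
  exact: cl.
Unshelve. all: by end_near. Qed.

(** * Speed of C^1 curves: independence of the chart and continuity *)

Section Speed.
Context {R : realType} {n : nat} (M : riemannianManifold R n).
Implicit Types (c : R -> M) (J : set R).

Lemma near_dom J c (t : R) (i : chart_index M) : open J -> C1_curve J c -> J t ->
  dom i (c t) -> \forall s \near t, (J `&` c @^-1` dom i) s.
Proof.
move=> oJ [cc _] Jt ct.
apply: filterI; first exact: open_nbhs_nbhs.
by apply: cc; [rewrite inE | apply: open_nbhs_nbhs; split => //; exact: dom_open].
Qed.

Lemma chart_transition_image (i j : chart_index M) (x : M) : dom i x -> dom j x ->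
  (chart i @` (dom i `&` dom j)) (chart i x).
Proof. by move=> ? ?; exists x. Qed.

Lemma transition_differentiable (i j : chart_index M) (x : M) :
  dom i x -> dom j x -> differentiable (chart j \o chart_inv i) (chart i x).
Proof.
move=> ix jx; have [_ [+ _]] := transition_smooth i j 1%N.
by apply; rewrite inE; exact: chart_transition_image.
Qed.

Lemma C1_curve_differentiable J c (t : R) (i : chart_index M) : C1_curve J c ->
  J t -> dom i (c t) -> differentiable (chart i \o c) t.
Proof. by move=> [_ /(_ i)[_ [+ _]]] Jt ct; apply; rewrite inE. Qed.

(** [speed] uses the preferred chart at [c t], which may jump as [t] varies. By the chain rule the
    velocity in that chart is the image of the velocity in chart [i] under the differential of the
    transition map, and [metric_transition] equates the two norms. *)
Lemma speed_chart J c (t : R) (i : chart_index M) : open J -> C1_curve J c ->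
  J t -> dom i (c t) ->
  let v := 'd (chart i \o c) t 1 in
  speed c t = Num.sqrt (gram (metric i (chart i (c t))) v v).
Proof.
move=> oJ C1c Jt ict /=.
set j := chart_at (c t).
have jct : dom j (c t) by exact: dom_chart_at.
rewrite (metric_transition ict jct) /speed -/j.
suff -> : derive1 (chart j \o c) t =
  'd (chart j \o chart_inv i) (chart i (c t)) ('d (chart i \o c) t 1) by [].
have dc := C1_curve_differentiable C1c Jt ict.
have dt := transition_differentiable ict jct.
rewrite -(derive1_diff_comp dc dt); apply: near_eq_derive1.
(* [chart j \o c] factors through chart [i] only while [c] stays in [dom i], that is near [t], which
   suffices for derivatives. *)
near=> s; rewrite /= chartK// inE.
have [] // : (J `&` c @^-1` dom i) s by near: s; exact: near_dom.
Unshelve. all: by end_near. Qed.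

Lemma metric_continuous (i : chart_index M) (p : 'rV[R]_n) :
  (chart i @` dom i) p -> {for p, continuous (metric i)}.
Proof. by move=> ip; have [+ _] := metric_smooth i 0%N; apply; rewrite inE. Qed.

Lemma speed_continuous J c : open J -> C1_curve J c ->
  {in J, continuous (speed c)}.
Proof.
move=> oJ C1c t; rewrite inE => Jt.
set i := chart_at (c t).
have ict : dom i (c t) by exact: dom_chart_at.
have [cc /(_ i)[ci [_ /(_ 1) [cd _]]]] := C1c.
have Ut : t \in J `&` c @^-1` dom i by rewrite inE.
(* [g] is the speed computed in the single chart [i] that is preferred at the time [t]; it agrees
   with [speed c] near [t] and is visibly continuous there. *)
pose g s := Num.sqrt (gram (metric i (chart i (c s)))
  ('d (chart i \o c) s 1) ('d (chart i \o c) s 1)).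
have gE : {near t, g =1 speed c}.
  near=> s; have [] : (J `&` c @^-1` dom i) s by near: s; exact: near_dom.
  by move=> Js cs; apply/esym; exact: (speed_chart oJ C1c).
suff : speed c @ t --> speed c t by [].
have -> : speed c t = g t by exact: (speed_chart oJ C1c).
apply: cvg_trans (near_eq_cvg gE) _.
apply: (@continuous_cvg _ _ _ _ _ (fun s => gram (metric i (chart i (c s)))
    ('d (chart i \o c) s 1) ('d (chart i \o c) s 1)) Num.sqrt).
  exact: sqrt_continuous.
apply: cvg_gram; [|exact: cd|exact: cd].
apply: (@continuous_cvg _ _ _ _ _ (chart i \o c) (metric i)); last exact: ci.
apply: metric_continuous.
by exists (c t).
Unshelve. all: by end_near. Qed.

Lemma speed_ge0 c (t : R) : 0 <= speed c t.
Proof. exact: sqrtr_ge0. Qed.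

Lemma near_eq_speed c c' (t : R) : {near t, c =1 c'} -> speed c t = speed c' t.
Proof.
move=> cc'; rewrite /speed (nbhs_singleton cc').
set i := chart_at _.
suff -> : derive1 (chart i \o c) t = derive1 (chart i \o c') t by [].
apply: near_eq_derive1.
by apply: filterS cc' => s /= ->.
Qed.

End Speed.

(** * Reflections of the real line: intervals, Lebesgue measure, derivatives *)

Section Reflection.
Context {R : realType}.
Implicit Types k a b t : R.

(** A bound lying just to the left of a point is reflected to one just to the right of its image,
    which negates and exchanges the two flags. *)
Lemma reflect_itv k a b (ba bb : bool) :
  (fun t => k - t) @^-1` [set` Interval (BSide ba a) (BSide bb b)] =
  [set` Interval (BSide (~~ bb) (k - b)) (BSide (~~ ba) (k - a))].
Proof.
apply/seteqP; split=> t /=; rewrite !itv_boundlr /= => /andP[];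
  case: ba; case: bb; rewrite /= !bnd_simp => ? ?; apply/andP; split; lra.
Qed.

Lemma measurable_reflect k : 
  measurable_fun [set: measurableTypeR R] (fun t => k - t : measurableTypeR R).
Proof. by apply: measurable_funB. Qed.

(** Lebesgue measure is determined by its values on the intervals []a, b]], whose preimages [[k - b,
    k - a[] have the same length. *)
Lemma lebesgue_measure_reflect k (A : set R) : measurable A ->
  pushforward lebesgue_measure
    (fun t : measurableTypeR R => k - t : measurableTypeR R) A =
  lebesgue_measure A.
Proof.
move=> mA; apply/esym/lebesgue_measure_unique => //=.
  exact: measurable_reflect.
move=> _ _ [[a b] _ <-].
rewrite /pushforward reflect_itv /= !lebesgue_measure_itv /=.
rewrite !lte_fin ltrD2l ltrN2; case: ifP => // _.
by rewrite -!EFinB; congr EFin; ring.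
Qed.

Lemma ge0_integral_reflect k (D : set R) (f : R -> \bar R) : measurable D ->
  measurable_fun D f -> {in D, forall t, (0 <= f t)%E} ->
  (\int[lebesgue_measure]_(t in (fun t => k - t)%R @^-1` D) f (k - t)%R =
   \int[lebesgue_measure]_(t in D) f t)%E.
Proof.
move=> mD mf f0.
have := ge0_integral_pushforward (measurable_reflect k) lebesgue_measure mD mf f0.
move=> <-; apply: eq_measure_integral => [|mphi A mA _].
  exact: measurable_reflect.
exact: lebesgue_measure_reflect.
Qed.

Lemma derivable_reflect (V : normedModType R) (f : R -> V) k t :
  derivable f (k - t) 1 -> derivable (fun s => f (k - s)) t 1.
Proof.
move=> /derivable1_diffP df; apply/derivable1_diffP.
by apply: (@differentiable_comp _ _ _ _ (fun s : R => k - s) f).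
Qed.

(* No derivability is assumed: where f is not derivable, both derivatives are
   the same junk value, whence the second alternative. *)
Lemma derive1_reflect (V : normedModType R) (f : R -> V) k t :
  derive1 (fun s => f (k - s)) t = - derive1 f (k - t) \/
  derive1 (fun s => f (k - s)) t = derive1 f (k - t).
Proof.
have [df|ndf] := pselect (derivable f (k - t) 1); [left|right].
  rewrite (@derive1_diff_comp _ _ _ (fun s : R => k - s) f t) //; last first.
    exact/derivable1_diffP.
  have dr : is_derive t 1 (fun s : R => k - s) (-1).
    by apply: is_derive_eq; rewrite add0r mul1r.
  have <- : 'D_1 (fun s : R => k - s) t = 'd (fun s : R => k - s) t 1.
    exact: deriveE.
  rewrite derive_val linearN /= derive1E deriveE //.
  exact/derivable1_diffP.
have junk (g : R -> V) s : ~ derivable g s 1 -> derive1 g s = point.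
  by move=> ndg; rewrite derive1E; exact: dvgP.
rewrite !junk// => dg; apply: ndf.
have -> : f = fun s => (fun u => f (k - u)) (k - s).
  by apply/funext => s; rewrite /= subKr.
by apply: (@derivable_reflect _ (fun u => f (k - u))); rewrite subKr.
Qed.

End Reflection.

(** * Piecewise C^1 curves: concatenation, restriction and reversal of lengths *)

Section Piecewise.
Context {R : realType} {n : nat} (M : riemannianManifold R n).
Implicit Types (c : R -> M) (a b d s t k : R).

Lemma piecewise_C1_nil b c : piecewise_C1 b b c.
Proof. by exists [::] => //; split=> /=. Qed.

Lemma piecewise_C1_cons a t b c : a < t -> C1_on_segment c a t ->
  piecewise_C1 t b c -> piecewise_C1 a b c.
Proof.
move=> lt_at c_at [s [ps /eqP lasts] cs]; exists (t :: s).
  by split; rewrite /= ?lt_at ?lasts.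
by case=> [//|k] /=; rewrite ltnS => /cs.
Qed.

(** Induction on the list of break points with the right end fixed; later proofs peel off the first
    C^1 piece and need not handle partitions. *)
Lemma piecewise_C1_ind (P : R -> Prop) b c : P b ->
  (forall a t, a < t -> C1_on_segment c a t -> piecewise_C1 t b c -> P t -> P a) ->
  forall a, piecewise_C1 a b c -> P a.
Proof.
move=> Pb Pcons a [s].
elim: s a => [|t s IHs] a absp cs; first by rewrite (itv_partition_nil absp).
have tbs := itv_partition_cons absp.
have ct (k : nat) : (k < size s)%N -> C1_on_segment c (nth b (t :: s) k) (nth b s k).
  by move=> ks; exact: (cs k.+1).
apply: (Pcons a t); [|exact: (cs 0%N)|by exists s|exact: IHs].
by have [/andP[]] := absp.
Qed.

Lemma piecewise_C1_le a b c : piecewise_C1 a b c -> a <= b.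
Proof. by move=> [s /itv_partition_le]. Qed.

Lemma C1_on_segment_eq a b c c' : {in `[a, b], c =1 c'} ->
  C1_on_segment c a b -> C1_on_segment c' a b.
Proof.
move=> cc' [J [e [oJ abJ C1e ce]]]; exists J, e; split=> // t tab.
by rewrite -cc'// ce.
Qed.

Lemma piecewise_C1_eq a b c c' : {in `[a, b], c =1 c'} ->
  piecewise_C1 a b c -> piecewise_C1 a b c'.
Proof.
move=> + cab; move: a cab.
apply: piecewise_C1_ind => [_|a t lt_at cat ctb IH cc'].
  exact: piecewise_C1_nil.
have le_tb := piecewise_C1_le ctb.
apply: (piecewise_C1_cons lt_at).
  apply: C1_on_segment_eq cat => u; rewrite in_itv/= => /andP[? ?].
  by apply: cc'; rewrite in_itv /=; apply/andP; split; lra.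
apply: IH => u; rewrite in_itv/= => /andP[? ?].
by apply: cc'; rewrite in_itv /=; apply/andP; split; lra.
Qed.

Lemma piecewise_C1_cat a b d c : piecewise_C1 a b c -> piecewise_C1 b d c ->
  piecewise_C1 a d c.
Proof.
move=> + cbd; move: a; apply: piecewise_C1_ind => // a t lt_at cat _.
exact: piecewise_C1_cons.
Qed.

(** The speed is continuous inside each piece, and its uncontrolled value at a break point does not
    affect measurability. *)
Lemma measurable_speed a b c : piecewise_C1 a b c ->
  measurable_fun `[a, b] (speed c).
Proof.
move: a; apply: piecewise_C1_ind.
  by rewrite set_itv1; exact: measurable_fun_set1.
move=> a t lt_at [J [e [oJ abJ C1e ce]]] /piecewise_C1_le le_tb mtb.
rewrite (@itv_bndbnd_setU _ _ _ (BLeft t)) ?bnd_simp//; last exact: ltW.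
apply/measurable_funU => //; split=> //.
apply/measurable_fun_itv_obnd_cbndP.
apply: open_continuous_measurable_fun; first exact: interval_open.
move=> u; rewrite inE /= in_itv /= => /andP[lt_au lt_ut].
have Ju : J u by apply: abJ; rewrite /= in_itv /= !ltW.
have ec : {near u, e =1 c}.
  near=> v; rewrite -?ce// in_itv /=.
  by apply/andP; split; apply: ltW; near: v;
    [exact: lt_nbhsr|exact: lt_nbhsl].
suff : speed c @ u --> speed c u by [].
rewrite -(near_eq_speed ec).
(* The speed at [v] depends on the curve around [v], so [c] and [e] have to agree near every [v]
   close to [u], whence [near_join]. *)
have es : {near u, speed e =1 speed c}.
  by apply: filterS (near_join ec) => v; exact: near_eq_speed.
apply: cvg_trans (near_eq_cvg es) _.
by apply: speed_continuous oJ C1e _ _; rewrite inE.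
Unshelve. all: by end_near. Qed.

(** The interval is cut into [[a, b]] and []b, d]]; adding the null point [b] to the second part
    does not change the integral. *)
Lemma curve_length_cat a b d c : piecewise_C1 a b c -> piecewise_C1 b d c ->
  curve_length a d c = (curve_length a b c + curve_length b d c)%E.
Proof.
move=> cab cbd; have cad := piecewise_C1_cat cab cbd.
have le_ab := piecewise_C1_le cab; have le_bd := piecewise_C1_le cbd.
have mad : measurable_fun `[a, d] (EFin \o speed c).
  by apply/measurable_EFinP; exact: measurable_speed.
rewrite /curve_length (@itv_bndbnd_setU _ _ _ (BRight b)) ?bnd_simp//.
rewrite ge0_integral_setU//=.
- rewrite integral_itv_obnd_cbnd//.
  apply: measurable_funS mad => // u /=; rewrite !in_itv /= => /andP[? ?].
  by apply/andP; split; lra.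
- by rewrite -itv_bndbnd_setU ?bnd_simp.
- by move=> u _; rewrite lee_fin speed_ge0.
- apply/disj_setPS => u [/=]; rewrite !in_itv /= => /andP[? ?] /andP[? ?].
  lra.
Qed.

(** The curves may differ outside [[a, b]], hence have different speeds at its end points; the
    integrals are therefore compared over []a, b[]. *)
Lemma curve_length_eq a b c c' : {in `[a, b], c =1 c'} ->
  piecewise_C1 a b c -> curve_length a b c = curve_length a b c'.
Proof.
move=> cc' cab; have c'ab := piecewise_C1_eq cc' cab.
have mo (e : R -> M) : piecewise_C1 a b e ->
    measurable_fun `]a, b[ (EFin \o speed e).
  move=> eab; apply/measurable_EFinP.
  by apply: measurable_funS (measurable_speed eab) => //; exact: subset_itv_oo_cc.
have oo (e : R -> M) : piecewise_C1 a b e -> curve_length a b e =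
    (\int[lebesgue_measure]_(u in `]a, b[) (speed e u)%:E)%E.
  by move=> /mo; exact: integral_itv_bndoo.
rewrite (oo _ cab) (oo _ c'ab); apply: eq_integral => u.
rewrite inE /= in_itv /= => /andP[lt_au lt_ub].
suff -> : speed c u = speed c' u by [].
apply: near_eq_speed.
near=> v; apply: cc'; rewrite in_itv /=.
by apply/andP; split; apply: ltW; near: v; [exact: lt_nbhsr|exact: lt_nbhsl].
Unshelve. all: by end_near. Qed.

(** The velocity changes sign, or is the same junk value; the quadratic form is even, so the speed
    is kept in both cases. *)
Lemma speed_reflect k c t : speed (fun s => c (k - s)) t = speed c (k - t).
Proof.
rewrite /speed; set i := chart_at _.
have [|] := @derive1_reflect R _ (chart i \o c) k t; rewrite /comp => ->//.
by rewrite gramNN.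
Qed.

Lemma open_dom_preimage (J : set R) c (i : chart_index M) : open J ->
  C1_curve J c -> open (J `&` c @^-1` dom i).
Proof. by move=> oJ C1c; rewrite openE => t [Jt ct]; exact: near_dom. Qed.

Lemma C1_curve_reflect k (J : set R) c : open J -> C1_curve J c ->
  C1_curve ((fun t => k - t) @^-1` J) (fun t => c (k - t)).
Proof.
have rE t : k - t = k + t *: (-1) :> R by rewrite /GRing.scale /=; ring.
move=> oJ C1c; have [cc C1i] := C1c; split=> [t|i].
  rewrite inE => Jt.
  apply: (@continuous_comp _ _ _ (fun t : R => k - t) c).
    by apply: cvgB; [exact: cvg_cst|exact: cvg_id].
  by apply: cc; rewrite inE.
exact: (class_C1_comp_affine (open_dom_preimage oJ C1c) rE (C1i i)).
Qed.

Lemma C1_on_segment_reflect k a b c : C1_on_segment c a b ->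
  C1_on_segment (fun t => c (k - t)) (k - b) (k - a).
Proof.
move=> [J [e [oJ abJ C1e ce]]].
have rab t : t \in `[k - b, k - a] -> k - t \in `[a, b].
  by rewrite !in_itv /= => /andP[? ?]; apply/andP; split; lra.
exists ((fun t => k - t) @^-1` J), (fun t => e (k - t)); split.
- apply: open_comp => // t _.
  by apply: cvgB; [exact: cvg_cst|exact: cvg_id].
- by move=> t /rab /abJ.
- exact: C1_curve_reflect.
- by move=> t /rab; exact: ce.
Qed.

Lemma piecewise_C1_reflect k a b c : piecewise_C1 a b c ->
  piecewise_C1 (k - b) (k - a) (fun t => c (k - t)).
Proof.
move: a; apply: piecewise_C1_ind => [|a t lt_at cat _ ctb].
  exact: piecewise_C1_nil.
(* Reflection reverses the order of the pieces: the first one, on [[a, t]], is now glued at the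
   right end. *)
apply: piecewise_C1_cat ctb _.
apply: (piecewise_C1_cons (t := k - a)); last exact: piecewise_C1_nil.
  by rewrite ltrD2l ltrN2.
exact: C1_on_segment_reflect.
Qed.

Lemma curve_length_reflect k a b c : piecewise_C1 a b c ->
  curve_length (k - b) (k - a) (fun t => c (k - t)) = curve_length a b c.
Proof.
move=> cab; rewrite /curve_length.
have mc : measurable_fun `[a, b] (EFin \o speed c).
  by apply/measurable_EFinP; exact: measurable_speed.
have <- := @ge0_integral_reflect R k `[a, b] (EFin \o speed c) _ mc.
- rewrite reflect_itv /=; apply: eq_integral => t _.
  by rewrite /= speed_reflect.
- exact: measurable_itv.
- by move=> t _; rewrite lee_fin speed_ge0.
Qed.

End Piecewise.

(** * Straight curves in charts, and lengths of curves joining two points *)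

Section Distance.
Context {R : realType} {n : nat} (M : riemannianManifold R n).
Implicit Types (c : R -> M) (x y z : M) (a b k : R).

Lemma chart_overlapE (i j : chart_index M) :
  chart i @` (dom i `&` dom j) =
  (chart i @` dom i) `&` (chart_inv i @^-1` dom j).
Proof.
apply/seteqP; split=> p.
  by move=> [x [ix jx] <-]; split; [exists x|rewrite /= chartK ?inE].
by move=> [[x ix <-]]; rewrite /= chartK ?inE// => jx; exists x.
Qed.

Lemma open_chart_overlap (i j : chart_index M) :
  open (chart i @` (dom i `&` dom j)).
Proof.
rewrite chart_overlapE openE => p [ip jp].
apply: filterI; first exact: open_nbhs_nbhs (conj (@cod_open _ _ M i) ip).
apply: (@chart_inv_continuous _ _ M i p); first by rewrite inE.
exact: open_nbhs_nbhs (conj (@dom_open _ _ M j) jp).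
Qed.

(** Read in a chart [j], the curve is a transition map composed with the affine map [l]. *)
Lemma C1_curve_chart_line (i : chart_index M) (l : R -> 'rV[R]_n)
    (p v : 'rV[R]_n) : (forall t, l t = p + t *: v) ->
  C1_curve (l @^-1` (chart i @` dom i)) (chart_inv i \o l : R -> M).
Proof.
move=> lE.
have cl : continuous l.
  have -> : l = fun t => p + t *: v by apply/funext.
  by move=> t; apply: cvgD; [exact: cvg_cst|apply: cvgZl; exact: cvg_id].
split=> [t|j].
  rewrite inE => it; apply: continuous_comp; first exact: cl.
  by apply: chart_inv_continuous; rewrite inE.
have := transition_smooth i j 1%N.
move=> /(class_C1_comp_affine (@open_chart_overlap i j) lE).
by rewrite chart_overlapE.
Qed.

(** The set whose infimum is [riemannian_edist x y]. *)
Definition curve_lengths x y : set (\bar R) :=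
  [set L | exists a b c,
    [/\ a <= b, piecewise_C1 a b c, c a = x, c b = y & L = curve_length a b c]].

Lemma curve_lengths_ge0 x y L : curve_lengths x y L -> (0 <= L)%E.
Proof.
move=> [a [b [c [_ _ _ _ ->]]]]; apply: integral_ge0 => t _.
by rewrite lee_fin speed_ge0.
Qed.

Lemma curve_lengths_sym x y : curve_lengths x y `<=` curve_lengths y x.
Proof.
move=> L [a [b [c [le_ab cab <- <- ->]]]].
exists (0 - b), (0 - a), (fun t => c (0 - t)); split.
- by rewrite !sub0r lerN2.
- exact: piecewise_C1_reflect.
- by rewrite subKr.
- by rewrite subKr.
- by rewrite curve_length_reflect.
Qed.

(* The translation of the parameter is obtained as a product of two
   reflections. *)
Lemma curve_lengths_from k x y L : curve_lengths x y L ->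
  exists b c, [/\ piecewise_C1 k b c, c k = x, c b = y & L = curve_length k b c].
Proof.
move=> [a [b [c [le_ab cab <- <- ->]]]].
have c'ab := piecewise_C1_reflect 0 cab.
have ka : k - a - (0 - a) = k by ring.
have c''ab := piecewise_C1_reflect (k - a) c'ab.
exists (k - a - (0 - b)), (fun t => c (0 - (k - a - t))); split.
- by rewrite -[X in piecewise_C1 X]ka.
- by congr c; ring.
- by congr c; ring.
- rewrite -[X in _ = curve_length X _ _]ka.
  by rewrite (curve_length_reflect _ c'ab) curve_length_reflect.
Qed.

Lemma curve_lengths_cat x y z L1 L2 : curve_lengths x y L1 ->
  curve_lengths y z L2 -> curve_lengths x z (L1 + L2)%E.
Proof.
move=> [a [b [c1 [le_ab c1ab <- c1b ->]]]].
move=> /(curve_lengths_from b)[d [c2 [c2bd c2b <- ->]]].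
pose c t := if t <= b then c1 t else c2 t.
have c1c : {in `[a, b], c1 =1 c}.
  by move=> t; rewrite in_itv /= => /andP[_ le_tb]; rewrite /c le_tb.
(* At [b] the definition of [c] selects [c1], but both curves pass through [y] there. *)
have c2c : {in `[b, d], c2 =1 c}.
  move=> t; rewrite in_itv /= le_eqVlt => /andP[/orP[/eqP<-|lt_bt] _].
    by rewrite /c lexx c1b.
  by rewrite /c leNgt lt_bt.
have cab := piecewise_C1_eq c1c c1ab; have cbd := piecewise_C1_eq c2c c2bd.
have le_bd := piecewise_C1_le cbd.
exists a, d, c; split.
- exact: le_trans le_bd.
- exact: piecewise_C1_cat cbd.
- by rewrite /c le_ab.
- by rewrite -c2c// in_itv /= lexx le_bd.
- apply/esym/(etrans (curve_length_cat cab cbd))/esym.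
  exact: congr2 (curve_length_eq c1c c1ab) (curve_length_eq c2c c2bd).
Qed.

(** If the coordinates of [y] lie in a ball around those of [x] inside the image of the chart, the
    coordinate segment between them lifts to a C^1 curve of finite length. *)
Lemma near_finite_length x :
  \forall y \near x, exists2 L, curve_lengths x y L & (L < +oo)%E.
Proof.
set i := chart_at x; have ix : dom i x by exact: dom_chart_at.
have /nbhs_ballP[e /= e0 ballW] : nbhs (chart i x) (chart i @` dom i).
  by apply: open_nbhs_nbhs; split; [exact: cod_open|exists x].
near=> y.
have iy : dom i y.
  by near: y; apply: open_nbhs_nbhs; split=> //; exact: dom_open.
have xye : ball (chart i x) e (chart i y).
  near: y; have ci := @chart_continuous _ _ M i x.
  by apply: ci; [rewrite inE | exact: nbhsx_ballx].
pose l t := chart i x + t *: (chart i y - chart i x).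
have C1l := @C1_curve_chart_line i l _ _ (fun=> erefl).
set J := l @^-1` _ in C1l.
have oJ : open J.
  apply: open_comp; last exact: cod_open.
  by move=> t _; apply: cvgD; [exact: cvg_cst|apply: cvgZl; exact: cvg_id].
have J01 : `[0, 1] `<=` J.
  move=> t; rewrite /= in_itv /= => /andP[t0 t1]; apply: ballW.
  (* The point [l t] is [t] times as far from the centre as [chart i y], and [t <= 1]. *)
  move: xye; rewrite -!ball_normE /= /l opprD addNKr normrN normrZ => xye.
  rewrite (le_lt_trans _ xye)// -[leRHS]mul1r distrC ger0_norm//.
  by rewrite ler_wpM2r.
pose c : R -> M := chart_inv i \o l.
have c01 : piecewise_C1 0 1 c.
  apply: (piecewise_C1_cons (t := 1)); [exact: ltr01| |exact: piecewise_C1_nil].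
  by exists J, c; split.
exists (curve_length 0 1 c).
  exists 0, 1, c; split=> //.
    by rewrite /c /= /l scale0r addr0 chartK ?inE.
  by rewrite /c /= /l scale1r subrKC chartK ?inE.
(* The length is finite because the speed is continuous on the compact [[0, 1]]. *)
apply: integrable_lty; first exact: measurable_itv.
apply: (@continuous_compact_integrable R (speed c)); first exact: segment_compact.
apply: continuous_in_subspaceT => t; rewrite inE => t01.
by apply: speed_continuous oJ C1l _ _; rewrite inE; exact: J01.
Unshelve. all: by end_near. Qed.

(** The points joined to [x] by a curve of finite length form a nonempty set that is both open and
    closed. *)
Lemma connected_finite_length x y : connected [set: M] ->
  exists2 L, curve_lengths x y L & (L < +oo)%E.
Proof.
move=> cM; pose B := [set y | exists2 L, curve_lengths x y L & (L < +oo)%E].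
suff : B = [set: M] by move=> BT; have : B y by rewrite BT.
apply: cM.
- by exists x; exact: nbhs_singleton (near_finite_length x).
- exists B; last by rewrite setTI.
  rewrite openE => z [L xzL Loo]; apply: filterS (near_finite_length z).
  move=> w [L' zwL' L'oo]; exists (L + L')%E; first exact: curve_lengths_cat zwL'.
  exact: lte_add_pinfty.
(* Closedness: if a point [w] near [z] were reachable from [x], so would be [z], by a curve to [w]
   followed by a reversed short curve from [z]. *)
- exists B; last by rewrite setTI.
  rewrite -openC openE => z nBz; apply: filterS (near_finite_length z).
  move=> w [L' zwL' L'oo] [L xwL Loo]; apply: nBz; exists (L + L')%E.
    exact: curve_lengths_cat xwL (curve_lengths_sym zwL').
  exact: lte_add_pinfty.
Qed.

(** * Symmetry, finiteness and triangle inequality of the distance *)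

Lemma riemannian_edistC x y : riemannian_edist x y = riemannian_edist y x.
Proof.
by congr ereal_inf; apply/seteqP; split; exact: curve_lengths_sym.
Qed.

Lemma riemannian_edist_fin_num x y : connected [set: M] ->
  riemannian_edist x y \is a fin_num.
Proof.
move=> /(connected_finite_length x y)[L xyL Loo].
rewrite ge0_fin_numE.
  by apply: le_lt_trans Loo; exact: ereal_inf_lbound.
by apply: le_ereal_inf_tmp => L' /curve_lengths_ge0.
Qed.

(** Finiteness of both infima provides curves within [e / 2] of them, and these are concatenated. *)
Lemma riemannian_edist_triangle x y z : connected [set: M] ->
  (riemannian_edist x z <= riemannian_edist x y + riemannian_edist y z)%E.
Proof.
move=> cM; apply/lee_addgt0Pr => e e0.
have e20 : 0 < e / 2 by rewrite divr_gt0.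
have [L1 xyL1 L1e] := lb_ereal_inf_adherent e20 (riemannian_edist_fin_num x y cM).
have [L2 yzL2 L2e] := lb_ereal_inf_adherent e20 (riemannian_edist_fin_num y z cM).
have le_xz : (riemannian_edist x z <= L1 + L2)%E.
  by apply: ereal_inf_lbound; exact: curve_lengths_cat yzL2.
apply: (le_trans le_xz); rewrite [e in leRHS]splitr EFinD addeACA.
by apply: leeD; exact: ltW.
Qed.

Lemma riemannian_distC x y : riemannian_dist x y = riemannian_dist y x.
Proof. by rewrite /riemannian_dist riemannian_edistC. Qed.

Lemma riemannian_dist_triangle x y z : connected [set: M] ->
  riemannian_dist x z <= riemannian_dist x y + riemannian_dist y z.
Proof.
move=> cM; have fin u v := riemannian_edist_fin_num u v cM.
by rewrite -lee_fin EFinD !fineK// riemannian_edist_triangle.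
Qed.

End Distance.

Theorem lemma3p2 (R : realType) (n : nat) (M : riemannianManifold R n)
  (M_connected : connected [set: M]) (M_complete : riemannian_complete M)
  (a : R) (a_gt0 : 0 < a) (a_lt1 : a < 1) (x y z : M) :
  F a x y z >= (riemannian_dist x z - a * riemannian_dist x y) ^+ 2.
Proof.
have xz_le := riemannian_dist_triangle x y z M_connected.
have xy_le := riemannian_dist_triangle x z y M_connected.
rewrite [riemannian_dist y z]riemannian_distC in xz_le; rewrite /F.
move: (riemannian_dist x z) (riemannian_dist x y) (riemannian_dist z y) xz_le xy_le.
move=> p r q pq rq.
rewrite -subr_ge0; set D := (X in 0 <= X).
(* The two triangle inequalities [p <= r + q] and [r <= p + q] say exactly that the factors
   [q - (p - r)] and [q + (p - r)] are nonnegative. *)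
have -> : D = a * ((q - (p - r)) * (q + (p - r))) by rewrite /D; ring.
by apply: mulr_ge0; [exact: ltW|apply: mulr_ge0; lra].
Qed.
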